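(* Let $\|\cdot\|$ be a norm on $\mathbb{R}^d$ with dual norm $\|\cdot\|_*$. Let $\Phi:\mathbb{R}^d\to\mathbb{R}$ be a Legendre function that is $\sigma$-strongly convex and $\beta$-smooth with respect to $\|\cdot\|$, where $0<\sigma\le\beta<\infty$. Let $f:\mathbb{R}^d\to\mathbb{R}$ be differentiable and $L$-smooth with respect to $\|\cdot\|$, $L>0$, and let $\Omega:\mathbb{R}^d\to\mathbb{R}^d$ be a vector field. Let $\mathbf{y}\in\mathbb{R}^d$ and define $$\delta(\mathbf{y}):=\begin{cases}\dfrac{\|\Omega(\mathbf{y})-\nabla f(\mathbf{y})\|_*}{\|\Omega(\mathbf{y})\|_*},&\Omega(\mathbf{y})\ne0,\\ 0,&\Omega(\mathbf{y})=\nabla f(\mathbf{y})=0,\\ +\infty,&\Omega(\mathbf{y})=0\ne\nabla f(\mathbf{y}).\end{cases}$$ If $\eta>0$ satisfies $$\eta\le\frac{\sigma^2}{L\beta}\left(1-\frac{2\beta}{\sigma}\delta(\mathbf{y})\right),$$ then, for $\mathbf{x}=\nabla\Phi^*\bigl(\nabla\Phi(\mathbf{y})-\eta\Omega(\mathbf{y})\bigr)$, $$\eta\,D_{f,\Omega}(\mathbf{x}\|\mathbf{y})\le D_\Phi(\mathbf{x}\|\mathbf{y}).$$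
   Context: The dual norm is $\|\mathbf{z}\|_*=\sup_{\|\mathbf{x}\|\le1}\langle\mathbf{z},\mathbf{x}\rangle$. A differentiable convex $g$ is $\sigma$-strongly convex with respect to $\|\cdot\|$ if $g(\mathbf{x})\ge g(\mathbf{y})+\langle\nabla g(\mathbf{y}),\mathbf{x}-\mathbf{y}\rangle+\frac{\sigma}{2}\|\mathbf{x}-\mathbf{y}\|^2$ for all $\mathbf{x},\mathbf{y}$. A differentiable $g$ is $L$-smooth with respect to $\|\cdot\|$ if $\|\nabla g(\mathbf{x})-\nabla g(\mathbf{y})\|_*\le L\|\mathbf{x}-\mathbf{y}\|$ for all $\mathbf{x},\mathbf{y}$. A Legendre function is a closed proper convex, essentially smooth and essentially strictly convex function; then $\nabla\Phi$ is one-to-one with inverse $\nabla\Phi^*$, $\Phi^*$ being the convex conjugate. $D_\Phi(\mathbf{x}\|\mathbf{y})=\Phi(\mathbf{x})-\Phi(\mathbf{y})-\langle\nabla\Phi(\mathbf{y}),\mathbf{x}-\mathbf{y}\rangle$ and $D_{f,\Omega}(\mathbf{x}\|\mathbf{y})=\langle\Omega(\mathbf{y}),\mathbf{y}-\mathbf{x}\rangle-f(\mathbf{y})+f(\mathbf{x})$. *)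

(* Defs.v *)
From mathcomp Require Import all_boot all_order all_algebra.
From mathcomp Require Import all_classical all_reals.
From mathcomp Require Import ereal topology normedtype sequences derive convex.

Set Implicit Arguments.
Unset Strict Implicit.
Unset Printing Implicit Defensive.

Import Order.TTheory GRing.Theory Num.Theory.
Import numFieldNormedType.Exports.

Local Open Scope classical_set_scope.
Local Open Scope ring_scope.

(* The ambient space is R^d = 'rV[R]_d.  Its library topology, used for
   differentiability and limits, comes from the max norm; as all norms on R^d
   are equivalent it is also the topology of the norm [N] below. *)

Section Euclidean.
Context {R : realType} {d : nat}.
Implicit Types (u v x y z : 'rV[R]_d).

Definition dot u v : R := \sum_i u 0 i * v 0 i.

Definition gradient (g : 'rV[R]_d -> R) x : 'rV[R]_d :=
  \row_i 'D_(delta_mx 0 i) g x.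

Record is_norm (N : 'rV[R]_d -> R) : Prop := IsNorm {
  is_norm_triangle : forall x y, N (x + y) <= N x + N y ;
  is_norm_homogeneous : forall (a : R) x, N (a *: x) = `|a| * N x ;
  is_norm_definite : forall x, N x = 0 -> x = 0
}.

Definition dual_norm (N : 'rV[R]_d -> R) z : R :=
  sup [set dot z x | x in [set x | N x <= 1]].

Definition strongly_convex (N : 'rV[R]_d -> R) (sigma : R)
    (g : 'rV[R]_d -> R) : Prop :=
  [/\ forall x, differentiable g x,
      convex_function (E := 'rV[R]_d) setT g &
      forall x y,
        g y + dot (gradient g y) (x - y) + sigma / 2 * N (x - y) ^+ 2 <= g x].

Definition smooth (N : 'rV[R]_d -> R) (L : R) (g : 'rV[R]_d -> R) : Prop :=
  (forall x, differentiable g x) /\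
  forall x y, dual_norm N (gradient g x - gradient g y) <= L * N (x - y).

Definition bregman (Phi : 'rV[R]_d -> R) x y : R :=
  Phi x - Phi y - dot (gradient Phi y) (x - y).

Definition field_divergence (f : 'rV[R]_d -> R) (Omega : 'rV[R]_d -> 'rV[R]_d)
    x y : R :=
  dot (Omega y) (y - x) - f y + f x.

Definition relative_error (N : 'rV[R]_d -> R) (f : 'rV[R]_d -> R)
    (Omega : 'rV[R]_d -> 'rV[R]_d) y : \bar R :=
  if Omega y != 0 then
    (dual_norm N (Omega y - gradient f y) / dual_norm N (Omega y))%:E
  else if gradient f y == 0 then 0%E else +oo%E.

End Euclidean.

(* Legendre functions in the sense of Rockafellar, Convex Analysis, Section 26,
   for extended-real-valued functions; real-valued ones are embedded by EFin. *)
Section Legendre.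
Context {R : realType} {d : nat}.
Implicit Types (g : 'rV[R]_d -> \bar R) (x y z : 'rV[R]_d).

Definition effective_domain g : set 'rV[R]_d := [set x | (g x < +oo)%E].

Definition proper g : Prop :=
  (forall x, (-oo < g x)%E) /\ effective_domain g !=set0.

Definition epigraph g : set ('rV[R]_d * R^o) :=
  [set p | (g p.1 <= (p.2 : R)%:E)%E].

(* For a proper convex function, being closed is being lower semicontinuous. *)
Definition closed_proper_convex g : Prop :=
  [/\ lower_semicontinuous g,
      proper g &
      convex_set (M := ('rV[R]_d * R^o)%type) (epigraph g)].

(* [g] is finite on the interior of its domain when it is proper, so that
   [fine \o g] is [g] near each point at which it is differentiated. *)
Definition essentially_smooth g : Prop :=
  let C := interior (effective_domain g) in
  [/\ C !=set0,
      forall x, C x -> differentiable (fine \o g) x &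
      forall (u : nat -> 'rV[R]_d) x,
        (forall n, C (u n)) -> (closure C `\` C) x ->
        u n @[n --> \oo] --> x ->
        `|gradient (fine \o g) (u n)| @[n --> \oo] --> +oo].

Definition subdifferential g x : set 'rV[R]_d :=
  [set z | forall y, (g x + (dot z (y - x))%:E <= g y)%E].

Definition essentially_strictly_convex g : Prop :=
  forall A : set 'rV[R]_d,
    A `<=` [set x | subdifferential g x !=set0] ->
    convex_set (M := 'rV[R]_d) A ->
    forall x y (t : R), A x -> A y -> x != y -> 0 < t < 1 ->
      (g (t *: x + (1 - t) *: y)%R < t%:E * g x + (1 - t)%:E * g y)%E.

Definition legendre g : Prop :=
  [/\ closed_proper_convex g, essentially_smooth g &
      essentially_strictly_convex g].

Definition convex_conjugate g z : \bar R :=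
  ereal_sup [set ((dot z x)%:E - g x)%E | x in setT].

End Legendre.

(* Main.v *)
(** Minimising the strongly convex, coercive function Phi - <z, .> shows that
every z is a gradient of Phi, and strong convexity squeezes the conjugate Phi*
at z = grad Phi(u) between its affine minorant of slope u and that minorant plus
|z' - z|_*^2 / (2 sigma); hence grad Phi*(z) = u, and the step satisfies
eta Omega(y) = grad Phi(y) - grad Phi(x).  With n = |x - y|, beta-smoothness
of Phi then gives eta |Omega(y)|_* <= beta n, and the descent inequality for f
gives eta D_{f,Omega}(x|y) <= (delta beta + eta L / 2) n^2.  The step size makes
this at most (sigma / 2) n^2, a lower bound of D_Phi(x|y). *)
Require Import Defs.
From mathcomp Require Import all_boot all_order all_algebra.
From mathcomp Require Import all_classical all_reals.
From mathcomp Require Import ereal topology normedtype sequences derive convex.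
From mathcomp Require Import realfun ring lra.

Import Order.TTheory GRing.Theory Num.Theory.
Import numFieldNormedType.Exports.

Local Open Scope classical_set_scope.
Local Open Scope ring_scope.

Set Implicit Arguments.
Unset Strict Implicit.
Unset Printing Implicit Defensive.

(** * The dot product, and derivatives along lines *)

Section DotProduct.
Context {R : realType} {d : nat}.
Implicit Types (u v w : 'rV[R]_d) (g : 'rV[R]_d -> R).

Lemma dotDl u v w : dot (u + v) w = dot u w + dot v w.
Proof.
by rewrite /dot -big_split; apply: eq_bigr => i _; rewrite mxE mulrDl.
Qed.

Lemma dotZl (a : R) u v : dot (a *: u) v = a * dot u v.
Proof. by rewrite /dot mulr_sumr; apply: eq_bigr => i _; rewrite mxE mulrA. Qed.

Lemma dotC u v : dot u v = dot v u.
Proof. by apply: eq_bigr => i _; rewrite mulrC. Qed.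

Lemma dotNl u v : dot (- u) v = - dot u v.
Proof. by rewrite -scaleN1r dotZl mulN1r. Qed.

Lemma dotBl u v w : dot (u - v) w = dot u w - dot v w.
Proof. by rewrite dotDl dotNl. Qed.

Lemma dotDr u v w : dot w (u + v) = dot w u + dot w v.
Proof. by rewrite dotC dotDl !(dotC w). Qed.

Lemma dotZr (a : R) u v : dot v (a *: u) = a * dot v u.
Proof. by rewrite dotC dotZl (dotC v). Qed.

Lemma dotNr u v : dot v (- u) = - dot v u.
Proof. by rewrite dotC dotNl (dotC v). Qed.

Lemma dotBr u v w : dot w (u - v) = dot w u - dot w v.
Proof. by rewrite dotDr dotNr. Qed.

Lemma dot0l v : dot 0 v = 0.
Proof. by rewrite -(scale0r 0) dotZl mul0r. Qed.

Lemma dot_delta u i : dot u (delta_mx 0 i) = u 0 i.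
Proof.
rewrite /dot (bigD1 i)//= big1 ?addr0 => [|j ji]; last first.
  by rewrite mxE/= (negPf ji) mulr0.
by rewrite mxE !eqxx mulr1.
Qed.

Lemma dot_continuous u : continuous (dot u).
Proof.
rewrite /dot; apply: continuous_big => [|i _ v]; first exact: add_continuous.
by apply: (cvgMl_tmp (FF := nbhs_filter v)); exact: coord_continuous.
Qed.

Lemma derive_gradient g u v : differentiable g u -> 'D_v g u = dot (gradient g u) v.
Proof.
move=> dg; rewrite deriveE// [v in LHS]row_sum_delta linear_sum/=.
apply: eq_bigr => i _.
by rewrite linearZ/= mxE deriveE// mulrC.
Qed.

(** The difference quotient of the restriction at [t] is the quotient of [g] at [u + t *: v] in
    direction [v]. This reduces the later inequalities to calculus in one variable. *)
Lemma is_derive_line g u v (t : R) : differentiable g (u + t *: v) ->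
  is_derive t 1 (fun s : R => g (u + s *: v)) (dot (gradient g (u + t *: v)) v).
Proof.
move=> dg; rewrite -(derive_gradient v dg).
have quotE : (fun h : R => h^-1 *:
      (g (u + (h *: (1 : R^o) + t) *: v) - g (u + t *: v)))
    = (fun h : R => h^-1 *: (g (h *: v + (u + t *: v)) - g (u + t *: v))).
  by apply/funext => h; rewrite scalerDl [h *: 1]mulr1 addrCA.
by apply: DeriveDef; rewrite /derivable /derive quotE//; exact: diff_derivable.
Qed.

End DotProduct.

(** * Norms on R^d, their duals, and smooth or strongly convex functions *)

Section NormTheory.
Context {R : realType} {d : nat} {N : 'rV[R]_d -> R}.
Hypothesis Nnorm : is_norm N.
Implicit Types (u v w z : 'rV[R]_d).

Lemma is_norm0 : N 0 = 0.
Proof. by rewrite -(scale0r 0) (is_norm_homogeneous Nnorm) normr0 mul0r. Qed.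

Lemma is_normN u : N (- u) = N u.
Proof. by rewrite -scaleN1r (is_norm_homogeneous Nnorm) normrN1 mul1r. Qed.

Lemma is_norm_ge0 u : 0 <= N u.
Proof.
by have := is_norm_triangle Nnorm u (- u); rewrite subrr is_norm0 is_normN; lra.
Qed.

Lemma coord_le_norm u i : `|u 0 i| <= `|u|.
Proof.
rewrite [leRHS]/Num.norm /= mx_normrE; apply/bigmax_geP; right => /=.
by exists (0, i).
Qed.

Lemma is_norm_sum (I : Type) (r : seq I) (F : I -> 'rV[R]_d) :
  N (\sum_(i <- r) F i) <= \sum_(i <- r) N (F i).
Proof.
elim/big_ind2 : _ => [|u a v b ua vb|//]; first by rewrite is_norm0.
by apply: le_trans (is_norm_triangle Nnorm _ _) _; exact: lerD.
Qed.

(** Expand [u] in the standard basis and bound each coordinate by the max norm. The summand 1 in the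
    constant keeps it positive even when d = 0. *)
Lemma is_norm_le_maxnorm : exists2 C, 0 < C & forall u, N u <= C * `|u|.
Proof.
have C0 : 0 <= \sum_i N (delta_mx 0 i) :> R.
  by apply: sumr_ge0 => i _; exact: is_norm_ge0.
exists (1 + \sum_i N (delta_mx 0 i)) => [|u]; first lra.
apply: (@le_trans _ _ ((\sum_i N (delta_mx 0 i)) * `|u|)); last first.
  by rewrite ler_wpM2r//; lra.
rewrite [u in N u]row_sum_delta; apply: le_trans (is_norm_sum _ _) _.
rewrite mulr_suml; apply: ler_sum => i _.
rewrite (is_norm_homogeneous Nnorm) mulrC ler_wpM2l ?is_norm_ge0//.
exact: coord_le_norm.
Qed.

Lemma is_norm_continuous : continuous N.
Proof.
have [C C0 NC] := is_norm_le_maxnorm.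
move=> u; apply/(cvgrPdist_lt (FF := nbhs_filter u)) => e e0.
have eC : 0 < C^-1 * e by rewrite mulr_gt0 ?invr_gt0.
have := nbhsx_ballx u _ eC; apply: filterS => v.
rewrite -ball_normE /ball_/= ltr_pdivlMl// => vu.
have := is_norm_triangle Nnorm (u - v) v.
have := is_norm_triangle Nnorm (v - u) u.
rewrite !subrK -(opprB u v) is_normN => uv vu'.
apply: le_lt_trans vu; apply: le_trans (NC _).
by rewrite ler_norml; lra.
Qed.

(** The constant is the minimum of the continuous [N] on the compact unit sphere of the max norm,
    positive by definiteness; homogeneity extends the bound to all vectors. *)
Lemma maxnorm_le_is_norm : exists2 c, 0 < c & forall u, c * `|u| <= N u.
Proof.
pose S := [set u : 'rV[R]_d | `|u| = 1].
(* An empty sphere means d = 0: every vector is then 0 and any constant serves. *)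
have [[u0 Su0]|S0] := pselect (S !=set0); last first.
  exists 1 => // u; have [->|u0] := eqVneq u 0.
    by rewrite normr0 mulr0 is_norm0.
  exfalso; apply: S0; exists (`|u|^-1 *: u).
  by rewrite /S/= normrZ normfV normr_id mulVf ?normr_eq0.
have Sc : compact S.
  apply: bounded_closed_compact.
    by exists 1; split => // M M1 u /= ->; exact: ltW.
  have /continuous_closedP normC := @norm_continuous _ 'rV[R]_d.
  exact: normC (@closed_eq _ _).
have [c Sc0 cmin] := EVT_min_rV (ex_intro _ _ Su0) Sc
  (continuous_subspaceT is_norm_continuous).
have {}Sc0 : `|c| = 1 by move: Sc0; rewrite inE.
have c0 : c != 0 by rewrite -normr_gt0 Sc0.
exists (N c) => [|u].
  rewrite lt_neqAle is_norm_ge0 andbT eq_sym.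
  by apply: contra c0 => /eqP /(is_norm_definite Nnorm) ->.
have [->|u0'] := eqVneq u 0; first by rewrite normr0 mulr0 is_norm0.
have := cmin (`|u|^-1 *: u); rewrite inE /S/=.
rewrite normrZ normfV normr_id mulVf ?normr_eq0// => /(_ erefl).
rewrite (is_norm_homogeneous Nnorm) normfV normr_id mulrC.
by rewrite ler_pdivlMr ?normr_gt0.
Qed.

(** Without an upper bound [sup] would return its default value; this makes [dual_norm] a true
    supremum. The bound comes from the unit ball of [N] being bounded in each coordinate. *)
Lemma dual_norm_has_ubound z :
  has_ubound [set dot z u | u in [set u | N u <= 1]].
Proof.
have [c c0 cN] := maxnorm_le_is_norm.
exists (\sum_i `|z 0 i| * c^-1) => _ [u /= Nu <-].
apply: le_trans (ler_norm _) _; apply: le_trans (ler_norm_sum _ _ _) _.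
apply: ler_sum => i _; rewrite normrM ler_wpM2l//.
apply: le_trans (coord_le_norm _ _) _.
rewrite -[leRHS]mulr1 ler_pdivlMl//; exact: le_trans (cN _) Nu.
Qed.

Lemma dual_norm_ge0 z : 0 <= dual_norm N z.
Proof.
apply: ub_le_sup; first exact: dual_norm_has_ubound.
by exists 0; rewrite /= ?is_norm0// dotC dot0l.
Qed.

Lemma dual_norm_le z (a : R) :
  (forall u, N u <= 1 -> dot z u <= a) -> dual_norm N z <= a.
Proof.
move=> za; apply: ge_sup => [|_ [u Nu <-]]; last exact: za.
by exists (dot z 0), 0 => //=; rewrite is_norm0.
Qed.

Lemma dot_le_dual_norm z u : dot z u <= dual_norm N z * N u.
Proof.
have [->|u0] := eqVneq u 0; first by rewrite dotC dot0l is_norm0 mulr0.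
have Nu : 0 < N u.
  rewrite lt_neqAle is_norm_ge0 andbT eq_sym.
  by apply: contra u0 => /eqP /(is_norm_definite Nnorm) ->.
rewrite -ler_pdivrMr// mulrC -dotZr.
apply: ub_le_sup; first exact: dual_norm_has_ubound.
exists ((N u)^-1 *: u) => //=.
by rewrite (is_norm_homogeneous Nnorm) normfV (gtr0_norm Nu) mulVf ?gt_eqF.
Qed.

Lemma dual_norm0 : dual_norm N 0 = 0.
Proof.
apply/le_anti; rewrite dual_norm_ge0 andbT.
by apply: dual_norm_le => u _; rewrite dot0l.
Qed.

Lemma dual_norm_eq0 z : dual_norm N z = 0 -> z = 0.
Proof.
move=> z0; apply/rowP => i; rewrite mxE -dot_delta; apply/le_anti.
have := dot_le_dual_norm z (delta_mx 0 i).
have := dot_le_dual_norm z (- delta_mx 0 i).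
by rewrite dotNr z0 !mul0r; lra.
Qed.

Lemma dual_norm_scale_le (a : R) z : dual_norm N (a *: z) <= `|a| * dual_norm N z.
Proof.
apply: dual_norm_le => u Nu; rewrite dotZl -dotZr.
apply: le_trans (dot_le_dual_norm _ _) _.
rewrite (is_norm_homogeneous Nnorm) mulrCA ler_wpM2l//.
by rewrite ler_piMr ?dual_norm_ge0.
Qed.

(** The descent lemma. Along the segment from [v] to [u], [phi] is [g] minus its quadratic majorant
    up to a constant; smoothness makes its derivative nonpositive, hence [phi 1 <= phi 0]. *)
Lemma smooth_le (L : R) g u v : smooth N L g ->
  g u <= g v + dot (gradient g v) (u - v) + L / 2 * N (u - v) ^+ 2.
Proof.
move=> [dg gL]; set w : 'rV[R]_d := u - v.
set a := dot (gradient g v) w; set b := L / 2 * N w ^+ 2.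
pose phi : R -> R :=
  (fun t : R => g (v + t *: w)) - (a \*: id + b \*: (id ^+ 2)).
have dphi (t : R) : is_derive t 1 phi
    (dot (gradient g (v + t *: w)) w - (a + 2 * t * b)).
  have := is_derive_line (dg (v + t *: w)) => dl.
  apply: is_derive_eq; rewrite /GRing.scale/=; ring.
have phi10 : phi 1 <= phi 0.
  apply: (@ler0_derive1_nincr _ phi 0 1) => //.
  - move=> t /[!in_itv]/= /andP[t0 _].
    rewrite derive1E derive_val.
    have : dot (gradient g (v + t *: w) - gradient g v) w <= 2 * t * b.
      apply: le_trans (dot_le_dual_norm _ _) _.
      have := gL (v + t *: w) v.
      rewrite (addrC v) addrK (is_norm_homogeneous Nnorm) gtr0_norm// => gLt.
      apply: le_trans (ler_wpM2r (is_norm_ge0 _) gLt) _.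
      by rewrite le_eqVlt; apply/orP; left; apply/eqP; rewrite /b; field.
    by rewrite dotBl -/a; lra.
  - by apply: derivable_within_continuous => t _.
move: phi10; rewrite /phi !fctE /= !scale1r scale0r addr0.
rewrite /w (addrC v) subrK -/w /GRing.scale/=; lra.
Qed.

(** Fermat's rule for the tilted function [g - dot z], applied along each coordinate axis through
    [c]. *)
Lemma gradient_at_min g c z : (forall u, differentiable g u) ->
  (forall u, g c - dot z c <= g u - dot z u) -> gradient g c = z.
Proof.
move=> dg cmin; apply/rowP => i; rewrite -!dot_delta; set v := delta_mx 0 i.
pose phi : R -> R := (fun t : R => g (c + t *: v)) - dot z v \*: id.
have dphi (t : R) : is_derive t 1 phi (dot (gradient g (c + t *: v)) v - dot z v).
  have := is_derive_line (dg (c + t *: v)) => dl.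
  apply: is_derive_eq; rewrite /GRing.scale/=; ring.
have : is_derive (0 : R) 1 phi 0.
  apply: (@derive1_at_min _ phi (-1) 1) => //; first by rewrite in_itv/=; lra.
  have phiE t : phi t = g (c + t *: v) - dot z v * t by [].
  move=> t _; rewrite !phiE scale0r addr0.
  by have := cmin (c + t *: v); rewrite dotDr dotZr; lra.
move=> d0; have := @derive_val _ _ _ _ _ _ _ (dphi 0).
by rewrite (@derive_val _ _ _ _ _ _ _ d0) scale0r addr0; lra.
Qed.

Lemma strongly_convex_gradient_surj (sigma : R) g z : 0 < sigma ->
  strongly_convex N sigma g -> exists u, gradient g u = z.
Proof.
move=> sigma0 [dg _ gsc].
pose h u := g u - dot z u.
set p := gradient g 0 - z; set A := dual_norm N (- p).
have A0 : 0 <= A := dual_norm_ge0 _.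
(* Strong convexity at 0 gives [h u - h 0 >= sigma / 2 * N u ^+ 2 - A * N u], which is nonnegative
   once [N u] exceeds this radius. A minimiser over the ball of radius [M], which contains 0, is
   therefore global. *)
pose M := 2 * A / sigma.
have M0 : 0 <= M by rewrite /M !mulr_ge0// invr_ge0 ltW.
have h_far u : M < N u -> h 0 <= h u.
  rewrite /M ltr_pdivrMr// => Mu.
  have := gsc u 0; have := dot_le_dual_norm (- p) u.
  rewrite -/A dotNl dotBl subr0 /h (dotC z 0) dot0l.
  have : 0 <= N u := is_norm_ge0 u.
  nra.
pose K := [set u | N u <= M].
have Kc : compact K.
  have [c c0 cN] := maxnorm_le_is_norm.
  apply: bounded_closed_compact.
    exists (M / c); split => [|r Mr u /= Ku]; first exact: num_real.
    apply: ltW; apply: le_lt_trans Mr.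
    by rewrite ler_pdivlMr// mulrC; exact: le_trans (cN _) Ku.
  have /continuous_closedP NcP := is_norm_continuous.
  exact: NcP (@closed_le _ _).
have hc : continuous h.
  move=> u; apply: (cvgB (FF := nbhs_filter u)).
    exact: differentiable_continuous (dg u).
  exact: dot_continuous.
have K0 : K 0 by rewrite /K/= is_norm0.
have [c _ cmin] := EVT_min_rV (ex_intro _ _ K0) Kc (continuous_subspaceT hc).
exists c; apply: gradient_at_min => // u.
have [uM|Mu] := leP (N u) M; first by apply: cmin; rewrite inE.
by apply: le_trans (h_far _ Mu); apply: cmin; rewrite inE.
Qed.

(** * The conjugate of a strongly convex function and its gradient *)

Lemma conjugate_ge g z u : ((dot z u - g u)%:E <= convex_conjugate (EFin \o g) z)%E.
Proof. by apply: ereal_sup_ubound; exists u. Qed.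

Lemma conjugate_le (sigma : R) g u z : 0 < sigma -> strongly_convex N sigma g ->
  (convex_conjugate (EFin \o g) z <=
   (dot z u - g u + dual_norm N (z - gradient g u) ^+ 2 / (2 * sigma))%:E)%E.
Proof.
move=> sigma0 [_ _ gsc]; apply: ge_ereal_sup => _ [w _ <-].
rewrite /= -EFinB lee_fin.
have := gsc w u; have := dot_le_dual_norm (z - gradient g u) (w - u).
set A := dual_norm N _; set n := N (w - u).
have : A * n - sigma / 2 * n ^+ 2 <= A ^+ 2 / (2 * sigma).
  (* Completing the square in [n]: the concave quadratic peaks at [n = A / sigma]. *)
  have -> : A ^+ 2 / (2 * sigma) =
      A * n - sigma / 2 * n ^+ 2 + (A - sigma * n) ^+ 2 / (2 * sigma).
    by field; rewrite gt_eqF.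
  by rewrite lerDl divr_ge0 ?sqr_ge0// mulr_ge0// ltW.
rewrite dotBl !dotBr; lra.
Qed.

(** The two bounds on the conjugate agree at [z] and differ by a quadratic term nearby, so each
    partial difference quotient of step [s] is within [|s| * K] of the matching coordinate of
    [u]. *)
Lemma conjugate_gradient (sigma : R) g u : 0 < sigma -> strongly_convex N sigma g ->
  gradient (fine \o convex_conjugate (EFin \o g)) (gradient g u) = u.
Proof.
move=> sigma0 gsc; set z := gradient g u; set h := fine \o _.
(* Finiteness everywhere ensures that [fine] does not alter the conjugate. *)
have conj_fin w : convex_conjugate (EFin \o g) w \is a fin_num.
  rewrite fin_numElt (lt_le_trans _ (conjugate_ge g w u)) ?ltNyr//=.
  exact: le_lt_trans (conjugate_le u w sigma0 gsc) (ltry _).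
have h_ge w : dot w u - g u <= h w.
  by rewrite -lee_fin fineK// conjugate_ge.
have h_le w : h w <= dot w u - g u + dual_norm N (w - z) ^+ 2 / (2 * sigma).
  by rewrite -lee_fin fineK// conjugate_le.
have hz : h z = dot z u - g u.
  apply/le_anti; rewrite h_ge andbT; apply: le_trans (h_le z) _.
  by rewrite subrr dual_norm0 expr0n/= mul0r addr0.
apply/rowP => i; rewrite mxE; set v := delta_mx 0 i.
pose K := dual_norm N v ^+ 2 / (2 * sigma).
have K0 : 0 <= K by rewrite divr_ge0 ?sqr_ge0// mulr_ge0// ltW.
have quot (s : R) : s != 0 -> `|u 0 i - s^-1 * (h (s *: v + z) - h z)| <= `|s| * K.
  move=> s0.
  have lo := h_ge (s *: v + z); have up := h_le (s *: v + z).
  rewrite -[u 0 i](mulKf s0) -mulrBr normrM normfV ler_pdivrMl ?normr_gt0//.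
  rewrite mulrA -normrM -expr2 (ger0_norm (sqr_ge0 s)).
  have vu : dot v u = u 0 i by rewrite dotC dot_delta.
  move: lo up; rewrite hz addrK dotDl dotZl vu => lo up.
  have : dual_norm N (s *: v) ^+ 2 / (2 * sigma) <= s ^+ 2 * K.
    rewrite /K mulrA ler_pM2r ?invr_gt0 ?mulr_gt0//.
    rewrite -(real_normK (num_real s)) -exprMn lerXn2r ?nnegrE ?dual_norm_ge0//.
      by rewrite mulr_ge0 ?dual_norm_ge0.
    exact: dual_norm_scale_le.
  by rewrite ler_norml; lra.
apply: cvg_lim => //; apply/cvgrPdist_lt => e e0.
near=> s.
have s0 : s != 0 by near: s; exact: nbhs_dnbhs_neq.
apply: le_lt_trans (quot s s0) _.
(* [K] may vanish, so [K + 1] is used as a positive divisor of [e]. *)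
apply: (@le_lt_trans _ _ (`|s| * (K + 1))); first by rewrite ler_wpM2l//; lra.
rewrite -ltr_pdivlMr; last lra.
near: s; apply: dnbhs0_lt; rewrite divr_gt0//; lra.
Unshelve. all: by end_near. Qed.

(** Passes from the extended-real error to a real [delta]. An infinite error would make the
    right-hand side of the step condition [-oo], which no real [eta] satisfies; when both vectors
    vanish, [delta = 0] works. *)
Lemma relative_errorE (k c eta : R) f Omega y : 0 < k -> 0 < c ->
  (eta%:E <= k%:E * (1 - c%:E * relative_error N f Omega y))%E ->
  exists delta : R, [/\ 0 <= delta, eta <= k * (1 - c * delta) &
    dual_norm N (Omega y - gradient f y) <= delta * dual_norm N (Omega y)].
Proof.
move=> k0 c0; rewrite /relative_error; have [O0|O0] /= := eqVneq (Omega y) 0.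
  case: eqVneq => [f0 /=|_]; last first.
    by rewrite gt0_muley ?lte_fin//= gt0_muleNy ?lte_fin// leeNy_eq.
  exists 0; split => //.
  by rewrite O0 f0 subrr dual_norm0 mul0r.
move=> le_eta; eexists; split; [|exact: le_eta|].
  by rewrite divr_ge0 ?dual_norm_ge0.
by rewrite divfK//; apply: contra O0 => /eqP /dual_norm_eq0 ->.
Qed.

End NormTheory.

(** * The divergence inequality for one mirror step *)

Theorem theorem5p1 (R : realType) (d : nat) (N : 'rV[R]_d -> R)
    (Phi f : 'rV[R]_d -> R) (Omega : 'rV[R]_d -> 'rV[R]_d)
    (sigma beta L eta : R) (x y : 'rV[R]_d) :
  is_norm N ->
  0 < sigma -> sigma <= beta ->
  legendre (EFin \o Phi) ->
  strongly_convex N sigma Phi ->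
  smooth N beta Phi ->
  0 < L ->
  smooth N L f ->
  0 < eta ->
  (eta%:E <= (sigma ^+ 2 / (L * beta))%:E
             * (1 - (2 * beta / sigma)%:E * relative_error N f Omega y))%E ->
  x = gradient (fine \o convex_conjugate (EFin \o Phi))
               (gradient Phi y - eta *: Omega y) ->
  eta * field_divergence f Omega x y <= bregman Phi x y.
Proof.
move=> Nnorm sigma0 sigma_beta _ Phisc Phism L0 fsm eta0 step xE.
have beta0 : 0 < beta by apply: lt_le_trans sigma_beta.
have [delta [delta0 eta_le Omega_err]] : exists delta : R,
    [/\ 0 <= delta, eta <= sigma ^+ 2 / (L * beta) * (1 - 2 * beta / sigma * delta) &
    dual_norm N (Omega y - gradient f y) <= delta * dual_norm N (Omega y)].
  apply: relative_errorE step => //; first by rewrite divr_gt0 ?exprn_gt0 ?mulr_gt0.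
  by rewrite divr_gt0 ?mulr_gt0.
(* Surjectivity writes the dual point as [gradient Phi u], and the conjugate's gradient sends it
   back to [u], so [x = u]. *)
have gradx : gradient Phi x = gradient Phi y - eta *: Omega y.
  have [u uE] := strongly_convex_gradient_surj Nnorm
    (gradient Phi y - eta *: Omega y) sigma0 Phisc.
  by rewrite xE -uE (conjugate_gradient Nnorm _ sigma0 Phisc).
set n := N (x - y).
have n0 : 0 <= n := is_norm_ge0 Nnorm _.
have Omega_le : eta * dual_norm N (Omega y) <= beta * n.
  rewrite mulrC -ler_pdivlMr//; apply: (dual_norm_le Nnorm) => u Nu.
  rewrite ler_pdivlMr// mulrC -dotZl.
  have -> : eta *: Omega y = gradient Phi y - gradient Phi x.
    by rewrite gradx subKr.
  apply: le_trans (dot_le_dual_norm Nnorm _ _) _.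
  apply: le_trans (ler_piMr (dual_norm_ge0 Nnorm _) Nu) _.
  by have := Phism.2 y x; rewrite -(opprB x y) (is_normN Nnorm).
have divergence_le : field_divergence f Omega x y <=
    delta * dual_norm N (Omega y) * n + L / 2 * n ^+ 2.
  have := smooth_le Nnorm x y fsm; rewrite -/n.
  (* Replacing [Omega y] by [gradient f y] in the divergence costs the error term bounded here; the
     remainder is controlled by the descent lemma. *)
  have := dot_le_dual_norm Nnorm (Omega y - gradient f y) (y - x).
  rewrite -[N (y - x)](is_normN Nnorm) opprB -/n.
  have := ler_wpM2r n0 Omega_err.
  rewrite /field_divergence dotBl !dotBr; lra.
have bregman_ge : sigma / 2 * n ^+ 2 <= bregman Phi x y.
  by have [_ _ /(_ x y)] := Phisc; rewrite /bregman -/n; lra.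
apply: le_trans bregman_ge.
apply: (@le_trans _ _ ((delta * beta + eta * L / 2) * n ^+ 2)).
  have := ler_wpM2l (ltW eta0) divergence_le.
  have := ler_wpM2l (mulr_ge0 delta0 n0) Omega_le.
  lra.
rewrite ler_wpM2r ?sqr_ge0//.
(* The goal is equivalent to [eta * L <= m]. The step condition times [L * beta] reads
   [eta * L * beta <= sigma * m]; this forces [m > 0], so [sigma * m <= beta * m], and [beta]
   cancels. *)
set m := sigma - 2 * beta * delta.
have etaLbeta : eta * L * beta <= sigma * m.
  have -> : sigma * m = sigma ^+ 2 / (L * beta) * (1 - 2 * beta / sigma * delta)
      * (L * beta).
    by rewrite /m; field; rewrite !gt_eqF.
  by rewrite -mulrA ler_wpM2r// mulr_ge0 ?ltW.
have m0 : 0 < m.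
  by rewrite -(pmulr_rgt0 _ sigma0); apply: lt_le_trans etaLbeta; rewrite !mulr_gt0.
have : eta * L <= m.
  rewrite -(ler_pM2r beta0); apply: le_trans etaLbeta _.
  by rewrite mulrC ler_wpM2l ?(ltW m0).
by rewrite /m; lra.
Qed.
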